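(* Let $m,n\ge2$ be integers, $\mathbb{K}$ an infinite field and $q\in\mathbb{K}^\times$ not a root of unity. Let $C$ be an $m\times n$ rectangular Cauchon diagram with associated restricted permutation $v\in S_{m+n}$, and let $K$ be the $\mathcal{H}$-prime of $\mathcal{O}_q(M_{m,n})$ with Cauchon diagram $C$. Label the squares in the bottom row of $C$ with $1,\dots,n$ from left to right and the squares in the rightmost column with $n,n+1,\dots,m+n-1$ from bottom to top. For $k\in\{1,\dots,m+n-1\}$ put $I_k=v(\{1,\dots,k\})$, $p_1(I_k)=I_k\cap\{1,\dots,m\}$, $p_2(I_k)=I_k\cap\{m+1,\dots,m+n\}$, and let $w_m^o(i)=m+1-i$ for $1\le i\le m$. Then the quantum minor defined by the chain rooted at box $k$ is exactly $$\Big[w_m^o\big(p_1(I_k)\big)\ \Big|\ \big(\{m+1,\dots,m+k\}\setminus p_2(I_k)\big)-m\Big]_q\qquad\text{if }k\in\{1,\dots,n\},$$ and $$\Big[w_m^o\big(p_1(I_k)\setminus\{1,\dots,k-n\}\big)\ \Big|\ \big(\{m+1,\dots,m+n\}\setminus p_2(I_k)\big)-m\Big]_q\qquad\text{if }k\in\{n+1,\dots,m+n-1\}.$$ Hence the multiplicative set $E_K$ generated by the quantum minors $[S_i|T_i]_q$ ($2\le i\le m+n$) corresponding to the terms of the Grassmann necklace $(K_1,\dots,K_{m+n})$ of $K$ is equal to the multiplicative set generated by the $m+n-1$ quantum minors displayed above (the Fryer–Yakimov separating Ore set for $K$).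
   Context: Quantum matrices: $\mathcal{O}_q(M_{m,n})$ is the $\mathbb{K}$-algebra generated by $X_{ij}$ ($1\le i\le m$, $1\le j\le n$) subject to, for all $i<k$, $j<l$: $X_{ij}X_{il}=qX_{il}X_{ij}$, $X_{ij}X_{kj}=qX_{kj}X_{ij}$, $X_{il}X_{kj}=X_{kj}X_{il}$, $X_{ij}X_{kl}-X_{kl}X_{ij}=(q-q^{-1})X_{il}X_{kj}$. For $S=\{s_1<\dots<s_r\}\subseteq\{1,\dots,m\}$, $T=\{t_1<\dots<t_r\}\subseteq\{1,\dots,n\}$, $[S|T]_q=\sum_{\sigma\in S_r}(-q)^{l(\sigma)}X_{s_1,t_{\sigma(1)}}\cdots X_{s_r,t_{\sigma(r)}}$; the empty minor is $1$. The torus $\mathcal{H}=(\mathbb{K}^\times)^{m+n}$ acts by $(\alpha,\beta)\cdot X_{ij}=\alpha_i\beta_jX_{ij}$; an $\mathcal{H}$-prime is an $\mathcal{H}$-invariant prime ideal. For a set $Y$ of integers, $Y-m=\{y-m:y\in Y\}$. Cauchon diagrams: an $m\times n$ Cauchon diagram is an $m\times n$ grid of squares, each coloured black or white, such that no black square has both a white square to its left in the same row and a white square above it in the same column. In quantum minors, rows are numbered $1,\dots,m$ from top to bottom and columns $1,\dots,n$ from left to right. The $\mathcal{H}$-primes of $\mathcal{O}_q(M_{m,n})$ are in bijection with $m\times n$ Cauchon diagrams (Cauchon); the bijection is characterised as follows. For a diagram $C$, form the directed graph whose vertices are the white squares, together with a source for each row (at its right end) and a sink for each column (at its bottom end), with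 edges from each row source to the rightmost white square of its row, from each white square to the next white square to its left in its row, from each white square to the next white square below it in its column, and from the lowest white square of each column to that column's sink. Then $[S|T]_q$ lies in the $\mathcal{H}$-prime of $C$ iff there is no family of $|S|$ pairwise vertex-disjoint directed paths joining the sources of the rows $S$ to the sinks of the columns $T$. Restricted permutation: let $s_i=(i\ i+1)\in S_{m+n}$. The square in the $a$-th row from the bottom and $c$-th column from the left carries $s_{a+c-1}$. The permutation $v$ is the product of the $s_i$ in the black squares of $C$, written down left to right along each row, rows taken from top to bottom; permutations are composed from right to left. Chains: for a white square $(x,y)$, the nearest white square strictly northwest of it (if there is any white square strictly above and strictly to the left) is the unique white square in that region simultaneously minimising the vertical and horizontal distance to $(x,y)$; for a black square the same is done in the weakly northwest region (weakly above and weakly to the left). The chain rooted at $(x,y)$ is $(x_1,y_1),\dots,(x_t,y_t)$, where $(x_1,y_1)=(x,y)$ if $(x,y)$ is white and is the nearest white square weakly northwest of $(x,y)$ if $(x,y)$ is black; $(x_{i+1},y_{i+1})$ is the nearest white square strictly northwest of $(x_i,y_i)$; and the chain stops when there is none. If $(x,y)$ is black with no white square weakly northwest, the chain is empty. The quantum minor defined by the chain has row set the set of rows and column set the set of columns of the squares of the chain (in the standard numbering above). Grassmann necklace of $K$: let $d=m+n$; an $m$-subset $I\subseteq\{1,\dots,d\}$ corresponds to the quantum minor $[S_I|T_I]_q$ with $S_I=\{1,\dots,m\}\setminus I$, $T_I=\{m+n+1-j:j\in I,\ j>m\}$. Let $\le_i$ be the total order $i<_ii+1<_i\dots<_id<_i1<_i\dots<_ii-1$,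 extended to $m$-subsets by comparing $r$-th smallest elements for all $r$. The Grassmann necklace of $K$ is $(K_1,\dots,K_d)$, with $K_i$ the $\le_i$-minimum of the set of $m$-subsets $I$ with $[S_I|T_I]_q\notin K$ (it exists; equivalently it is the Grassmann necklace of the totally nonnegative cell with the same Cauchon diagram as $K$). Put $S_i=S_{K_i}$, $T_i=T_{K_i}$. *)

(* Defs.v *)
From HB Require Import structures.
From mathcomp Require Import all_boot all_algebra perm.
From mathcomp Require Import boolp classical_sets functions cardinality.
From mathcomp Require Import monalg zify.

Set Implicit Arguments.
Unset Strict Implicit.
Unset Printing Implicit Defensive.

Import GRing.Theory.
Local Open Scope ring_scope.
Local Open Scope quotient_scope.

(* Conventions: all indices are 0-based, so that i : 'I_m stands for the
   integer i + 1 of the usual 1-based numbering of 1, ..., m; the rows of a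
   grid are numbered from top to bottom and its columns from left to right.
   In 'I_(m + n), [lshift n i] is the element i of {1, ..., m} and
   [rshift m j] is the element m + j of {m+1, ..., m+n}, up to this shift. *)

Section Ideals.
Variable R : nzRingType.
Implicit Types I J P : set R.

Definition two_sided_ideal I : Prop :=
  [/\ I 0, forall x y, I x -> I y -> I (x - y)
    & forall a x, I x -> I (a * x) /\ I (x * a)].

Definition prime_ideal P : Prop :=
  [/\ two_sided_ideal P, ~ P 1
    & forall I J, two_sided_ideal I -> two_sided_ideal J ->
        (forall x y, I x -> J y -> P (x * y)) ->
        (I `<=` P)%classic \/ (J `<=` P)%classic].

Definition mul_submonoid I : Prop :=
  I 1 /\ forall x y, I x -> I y -> I (x * y).

Definition mulgen I : set R := smallest mul_submonoid I.

Lemma smallest_ideal I : two_sided_ideal (smallest two_sided_ideal I).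
Proof.
split=> [J [[]]//|x y Ix Iy J iJ|a x Ix].
  by have [[_ subJ _] _] := iJ; apply: subJ; [apply: Ix|apply: Iy].
by split=> J iJ; have [[_ _ mulJ] _] := iJ; have [] := mulJ a x (Ix J iJ).
Qed.

Record proper_ideal := ProperIdeal {
  ideal_set :> set R;
  ideal_set_ideal : two_sided_ideal ideal_set;
  ideal_set1 : ~ ideal_set 1 }.

End Ideals.


Section IdealQuotient.
Variables (F : comNzRingType) (A : algType F) (I : proper_ideal A).
Local Notation J := (ideal_set I).

Let ideal0 : J 0. Proof. by case: (ideal_set_ideal I). Qed.
Let idealB x y : J x -> J y -> J (x - y).
Proof. by case: (ideal_set_ideal I) => _ + _; apply. Qed.
Let idealN x : J x -> J (- x).
Proof. by rewrite -[- x]add0r; apply: idealB. Qed.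
Let idealD x y : J x -> J y -> J (x + y).
Proof. by move=> ix iy; rewrite -[y]opprK; apply: idealB => //; apply: idealN. Qed.
Let idealMl a x : J x -> J (a * x).
Proof. by case: (ideal_set_ideal I) => _ _ IM /(IM a)[]. Qed.
Let idealMr a x : J x -> J (x * a).
Proof. by case: (ideal_set_ideal I) => _ _ IM /(IM a)[]. Qed.

Definition ideal_eqv : rel A := fun x y => `[< J (x - y) >].

Lemma ideal_eqv_equiv : equiv_class_of ideal_eqv.
Proof.
split=> [x|x y|y x z].
- by apply/asboolP; rewrite subrr.
- by apply/asboolP/asboolP => /idealN; rewrite opprB.
- move=> /asboolP xy /asboolP yz; apply/asboolP.
  by rewrite -[x](subrK y) -addrA; apply: idealD.
Qed.

Canonical ideal_equivRel := EquivRelPack ideal_eqv_equiv.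

Definition quot := {eq_quot ideal_eqv}.

HB.instance Definition _ := Choice.on quot.
HB.instance Definition _ := EqQuotient.on quot.

Definition qpi : A -> quot := \pi_quot.

Lemma qpiP x y : qpi x = qpi y <-> J (x - y).
Proof.
by split=> [/eqquotP/asboolP|xy]; last by apply/eqquotP/asboolP.
Qed.

Lemma qpiK x : J (repr (qpi x) - x).
Proof. by apply/qpiP; rewrite /qpi reprK. Qed.

Lemma qpi_ind (P : quot -> Prop) : (forall x, P (qpi x)) -> forall x, P x.
Proof. by move=> Px x; rewrite -[x]reprK; apply: Px. Qed.

Definition quot_add (x y : quot) := qpi (repr x + repr y).
Definition quot_opp (x : quot) := qpi (- repr x).
Definition quot_mul (x y : quot) := qpi (repr x * repr y).
Definition quot_scale (c : F) (x : quot) := qpi (c *: repr x).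

Let addE x y : quot_add (qpi x) (qpi y) = qpi (x + y).
Proof. by apply/qpiP; rewrite opprD addrACA; apply: idealD; apply: qpiK. Qed.
Let oppE x : quot_opp (qpi x) = qpi (- x).
Proof. by apply/qpiP; rewrite -opprD; apply/idealN/qpiK. Qed.
Let mulE x y : quot_mul (qpi x) (qpi y) = qpi (x * y).
Proof.
apply/qpiP; set x' := repr _; set y' := repr _.
have -> : x' * y' - x * y = (x' - x) * y' + x * (y' - y).
  by rewrite mulrBl mulrBr addrA subrK.
by apply: idealD; [apply/idealMr/qpiK|apply/idealMl/qpiK].
Qed.
Let scaleE c x : quot_scale c (qpi x) = qpi (c *: x).
Proof.
by apply/qpiP; rewrite -scalerBr -mulr_algl; apply/idealMl/qpiK.
Qed.

Let addA : associative quot_add.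
Proof.
by elim/qpi_ind=> x; elim/qpi_ind=> y; elim/qpi_ind=> z; rewrite !addE addrA.
Qed.
Let addC : commutative quot_add.
Proof. by elim/qpi_ind=> x; elim/qpi_ind=> y; rewrite !addE addrC. Qed.
Let add0 : left_id (qpi 0) quot_add.
Proof. by elim/qpi_ind=> x; rewrite addE add0r. Qed.
Let addN : left_inverse (qpi 0) quot_opp quot_add.
Proof. by elim/qpi_ind=> x; rewrite oppE addE addNr. Qed.

HB.instance Definition _ := GRing.isZmodule.Build quot addA addC add0 addN.

Let addRE x y : qpi x + qpi y = qpi (x + y). Proof. exact: addE. Qed.

Let mulA : associative quot_mul.
Proof.
by elim/qpi_ind=> x; elim/qpi_ind=> y; elim/qpi_ind=> z; rewrite !mulE mulrA.
Qed.
Let mul1x : left_id (qpi 1) quot_mul.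
Proof. by elim/qpi_ind=> x; rewrite mulE mul1r. Qed.
Let mulx1 : right_id (qpi 1) quot_mul.
Proof. by elim/qpi_ind=> x; rewrite mulE mulr1. Qed.
Let mulDl : left_distributive quot_mul +%R.
Proof.
elim/qpi_ind=> x; elim/qpi_ind=> y; elim/qpi_ind=> z.
by rewrite addRE !mulE addRE mulrDl.
Qed.
Let mulDr : right_distributive quot_mul +%R.
Proof.
elim/qpi_ind=> x; elim/qpi_ind=> y; elim/qpi_ind=> z.
by rewrite addRE !mulE addRE mulrDr.
Qed.
Let one_neq0 : qpi 1 != 0.
Proof. by apply/eqP => /qpiP; rewrite subr0; apply: ideal_set1. Qed.

HB.instance Definition _ :=
  GRing.Zmodule_isNzRing.Build quot mulA mul1x mulx1 mulDl mulDr one_neq0.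

Let scaleA a b x : quot_scale a (quot_scale b x) = quot_scale (a * b) x.
Proof. by elim/qpi_ind: x => x; rewrite !scaleE scalerA. Qed.
Let scale1 : left_id 1 quot_scale.
Proof. by elim/qpi_ind=> x; rewrite scaleE scale1r. Qed.
Let scaleDr : right_distributive quot_scale +%R.
Proof.
move=> c; elim/qpi_ind=> x; elim/qpi_ind=> y.
by rewrite addRE !scaleE addRE scalerDr.
Qed.
Let scaleDl x : {morph quot_scale^~ x : a b / a + b}.
Proof. by move=> a b; elim/qpi_ind: x => x; rewrite !scaleE addRE scalerDl. Qed.

HB.instance Definition _ :=
  GRing.Zmodule_isLmodule.Build F quot scaleA scale1 scaleDr scaleDl.

Let scaleAl (c : F) (x y : quot) : c *: (x * y) = (c *: x) * y.
Proof.
elim/qpi_ind: x => x; elim/qpi_ind: y => y.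
by rewrite /GRing.mul /GRing.scale /= !(mulE, scaleE) scalerAl.
Qed.
HB.instance Definition _ := GRing.Lmodule_isLalgebra.Build F quot scaleAl.

Let scaleAr (c : F) (x y : quot) : c *: (x * y) = x * (c *: y).
Proof.
elim/qpi_ind: x => x; elim/qpi_ind: y => y.
by rewrite /GRing.mul /GRing.scale /= !(mulE, scaleE) scalerAr.
Qed.
HB.instance Definition _ := GRing.Lalgebra_isAlgebra.Build F quot scaleAr.

Fact qpi_is_zmod_morphism : zmod_morphism qpi.
Proof. by move=> x y; rewrite -addE -oppE. Qed.
HB.instance Definition _ :=
  GRing.isZmodMorphism.Build A quot qpi qpi_is_zmod_morphism.
Fact qpi_is_monoid_morphism : monoid_morphism qpi.
Proof. by split=> // x y; rewrite -mulE. Qed.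
HB.instance Definition _ :=
  GRing.isMonoidMorphism.Build A quot qpi qpi_is_monoid_morphism.
Fact qpi_is_scalable : scalable qpi.
Proof. by move=> c x; rewrite -scaleE. Qed.
HB.instance Definition _ :=
  GRing.isScalable.Build F A quot *:%R qpi qpi_is_scalable.

End IdealQuotient.

(* The free algebra on V, as the algebra of the free monoid on V. *)
Section FreeAlgebra.
Variables (F : fieldType) (V : choiceType).

Definition freealg := {malg F[{fmonom V}]}.
HB.instance Definition _ := GRing.Lalgebra.on freealg.

Let fscaleAr (c : F) (x y : freealg) : c *: (x * y) = x * (c *: y).
Proof.
have malgC_comm (z : freealg) : c%:MP * z = z * c%:MP.
  rewrite !malgM_def fgmulUg fgmulgU; apply: eq_bigr => w _.
  by rewrite mul1m mulm1 mulrC.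
by rewrite -!mul_malgC mulrA malgC_comm mulrA.
Qed.
HB.instance Definition _ := GRing.Lalgebra_isAlgebra.Build F freealg fscaleAr.

Definition fvar (v : V) : freealg := << fmu v >>.

Section Lift.
Variables (B : algType F) (f : V -> B).

Definition fprod (w : {fmonom V}) : B := \prod_(v <- w) f v.

Fact fprod_is_mmorphism : mmorphism fprod.
Proof.
split=> [w1 w2|]; last by rewrite /fprod fm1 big_nil.
by rewrite /fprod fmM big_cat.
Qed.
HB.instance Definition _ :=
  monalg.isMultiplicative.Build {fmonom V} B fprod fprod_is_mmorphism.

Definition flift : freealg -> B := mmap (in_alg B) fprod.

Fact flift_is_zmod_morphism : zmod_morphism flift.
Proof. by move=> x y; rewrite /flift mmapB. Qed.
HB.instance Definition _ :=
  GRing.isZmodMorphism.Build freealg B flift flift_is_zmod_morphism.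

Fact flift_is_monoid_morphism : monoid_morphism flift.
Proof.
have [] := @commr_mmap_is_multiplicative {fmonom V} F B (in_alg B) fprod.
  by move=> x w w'; rewrite /GRing.comm /= mulr_algl mulr_algr.
by split.
Qed.
HB.instance Definition _ :=
  GRing.isMonoidMorphism.Build freealg B flift flift_is_monoid_morphism.

Fact flift_is_scalable : scalable flift.
Proof. by move=> c x; rewrite /flift mmapZ /= mulr_algl. Qed.
HB.instance Definition _ :=
  GRing.isScalable.Build F freealg B *:%R flift flift_is_scalable.

Lemma flift_var v : flift (fvar v) = f v.
Proof. by rewrite /flift mmapU /= scale1r mul1r /fprod fmU big_seq1. Qed.

End Lift.
End FreeAlgebra.

Lemma ker_ideal (A B : nzRingType) (g : {rmorphism A -> B}) :
  two_sided_ideal [set x | g x = 0]%classic.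
Proof.
split=> [|x y /= gx gy|a x /= gx] /=; first exact: rmorph0.
  by rewrite rmorphB gx gy subr0.
by rewrite !rmorphM gx mulr0 mul0r.
Qed.

Section QuotientLift.
Variables (F : comNzRingType) (A B : algType F) (I : proper_ideal A).
Variable g : {lrmorphism A -> B}.
Hypothesis g0 : forall x, ideal_set I x -> g x = 0.

Let h (x : quot I) := g (repr x).

Lemma quot_lift_pi x : g (repr (qpi I x)) = g x.
Proof. by apply/eqP; rewrite -subr_eq0 -rmorphB; apply/eqP/g0/qpiK. Qed.

Let hP x : h (qpi I x) = g x. Proof. exact: quot_lift_pi. Qed.

Lemma quot_lift_zmod : zmod_morphism h.
Proof.
by elim/qpi_ind=> x; elim/qpi_ind=> y; rewrite -rmorphB !hP rmorphB.
Qed.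
Lemma quot_lift_monoid : monoid_morphism h.
Proof.
split=> [|]; first by rewrite -(rmorph1 (qpi I)) hP rmorph1.
by elim/qpi_ind=> x; elim/qpi_ind=> y; rewrite -rmorphM !hP rmorphM.
Qed.
Lemma quot_lift_scalable : scalable h.
Proof. by move=> c; elim/qpi_ind=> x; rewrite -linearZ !hP linearZ. Qed.

End QuotientLift.

Section QuantumMatrices.
Variables (m n : nat) (F : fieldType) (q : F).

(* The defining relations of quantum matrices, written as r = 0; the row (resp.
   column) relations are imposed in every row (resp. column). *)
Inductive qmx_rel (B : algType F) (Y : 'I_m -> 'I_n -> B) : B -> Prop :=
| Qrow (i : 'I_m) (j l : 'I_n) of (j < l)%N :
    qmx_rel Y (Y i j * Y i l - q *: (Y i l * Y i j))
| Qcol (i k : 'I_m) (j : 'I_n) of (i < k)%N :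
    qmx_rel Y (Y i j * Y k j - q *: (Y k j * Y i j))
| Qanti (i k : 'I_m) (j l : 'I_n) of (i < k)%N & (j < l)%N :
    qmx_rel Y (Y i l * Y k j - Y k j * Y i l)
| Qdiag (i k : 'I_m) (j l : 'I_n) of (i < k)%N & (j < l)%N :
    qmx_rel Y (Y i j * Y k l - Y k l * Y i j - (q - q^-1) *: (Y i l * Y k j)).

Lemma qmx_rel_morph (A B : algType F) (g : {lrmorphism A -> B})
    (Y : 'I_m -> 'I_n -> A) r :
  qmx_rel Y r -> qmx_rel (fun i j => g (Y i j)) (g r).
Proof.
have gB x y : g (x - y) = g x - g y by exact: rmorphB.
have gM x y : g (x * y) = g x * g y by exact: rmorphM.
have gZ c x : g (c *: x) = c *: g x by exact: linearZ.
set Z := fun i j => _.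
by case=> *; rewrite !(gB, gZ, gM); [apply: (Qrow Z)|apply: (Qcol Z)
  |apply: (Qanti Z)|apply: (Qdiag Z)].
Qed.

Lemma qmx_rel_morph_inv (A B : algType F) (g : {lrmorphism A -> B})
    (Y : 'I_m -> 'I_n -> A) r :
  qmx_rel (fun i j => g (Y i j)) r -> exists2 s, qmx_rel Y s & g s = r.
Proof.
have gB x y : g (x - y) = g x - g y by exact: rmorphB.
have gM x y : g (x * y) = g x * g y by exact: rmorphM.
have gZ c x : g (c *: x) = c *: g x by exact: linearZ.
by case=> *; (eexists; last first); [rewrite -!(gM, gZ, gB); reflexivity|apply: (Qrow Y)|
  rewrite -!(gM, gZ, gB); reflexivity|apply: (Qcol Y)|
  rewrite -!(gM, gZ, gB); reflexivity|apply: (Qanti Y)|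
  rewrite -!(gM, gZ, gB); reflexivity|apply: (Qdiag Y)].
Qed.

(* The relations are homogeneous for the torus action. *)
Lemma qmx_rel_torus (B : algType F) (Y : 'I_m -> 'I_n -> B) a b r :
  (forall s, qmx_rel Y s -> s = 0) ->
  qmx_rel (fun i j => (a i * b j) *: Y i j) r -> r = 0.
Proof.
move=> Y0; have E c d (x y : B) : (c *: x) * (d *: y) = (c * d) *: (x * y).
  by rewrite -scalerAl -scalerAr scalerA.
case=> [i j l jl|i k j ik|i k j l ik jl|i k j l ik jl]; rewrite !E.
- rewrite (mulrC (a i * b l)) scalerA (mulrC q) -(scalerA _ q) -scalerBr.
  by rewrite (Y0 _ (Qrow Y i jl)) scaler0.
- rewrite (mulrC (a k * b j)) scalerA (mulrC q) -(scalerA _ q) -scalerBr.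
  by rewrite (Y0 _ (Qcol Y j ik)) scaler0.
- rewrite (mulrC (a k * b j)) -scalerBr.
  by rewrite (Y0 _ (Qanti Y ik jl)) scaler0.
- rewrite (mulrC (a k * b l)) -scalerBr.
  have -> : a i * b l * (a k * b j) = a i * b j * (a k * b l).
    by rewrite mulrACA (mulrC (b l)) mulrACA.
  rewrite scalerA (mulrC (q - _)) -(scalerA _ (q - _)) -scalerBr.
  by rewrite (Y0 _ (Qdiag Y ik jl)) scaler0.
Qed.

Local Notation FA := (freealg F ('I_m * 'I_n)%type).

Definition qmx_gen : set FA := qmx_rel (fun i j => fvar F (i, j)).

Lemma qmx_ideal_flift (B : algType F) (f : 'I_m * 'I_n -> B) r :
  (forall s, qmx_rel (fun i j => f (i, j)) s -> s = 0) ->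
  smallest (@two_sided_ideal FA) qmx_gen r -> flift f r = 0.
Proof.
move=> f0 /(_ [set x | flift f x = 0]%classic); apply.
split=> [|s /(qmx_rel_morph (flift f)) fs]; first exact: (ker_ideal (flift f)).
apply: f0; congr (qmx_rel _ _): fs; apply/funext => i; apply/funext => j.
exact: flift_var.
Qed.

Fact qmx_gen1 : ~ smallest (@two_sided_ideal FA) qmx_gen 1.
Proof.
move=> h; pose f (_ : 'I_m * 'I_n) : F^o := 0.
have : flift f 1 = 0.
  apply: (@qmx_ideal_flift F^o f 1 _ h) => s [] *;
    by rewrite !mulr0 ?scaler0 !subr0.
by rewrite rmorph1 => /eqP; rewrite oner_eq0.
Qed.

Definition qmx_ideal : proper_ideal FA := ProperIdeal (smallest_ideal _) qmx_gen1.

Definition qmatrix := quot qmx_ideal.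
HB.instance Definition _ := GRing.Algebra.on qmatrix.

Definition qX (i : 'I_m) (j : 'I_n) : qmatrix := qpi qmx_ideal (fvar F (i, j)).

Lemma qX_rel r : qmx_rel qX r -> r = 0.
Proof.
case/(qmx_rel_morph_inv (g := qpi qmx_ideal)) => s gs <-.
rewrite -(rmorph0 (qpi qmx_ideal)); apply/qpiP; rewrite subr0.
by move=> J [_]; apply.
Qed.

Section Torus.
Variables (a : 'I_m -> F) (b : 'I_n -> F).

Let f (ij : 'I_m * 'I_n) : qmatrix := (a ij.1 * b ij.2) *: qX ij.1 ij.2.

(* The automorphism X_ij |-> a_i b_j X_ij, see torus_actX. *)
Definition torus_act (x : qmatrix) : qmatrix := flift f (repr x).

Let f0 x : ideal_set qmx_ideal x -> flift f x = 0.
Proof.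
apply: qmx_ideal_flift => s fs.
exact: (@qmx_rel_torus _ qX a b s qX_rel fs).
Qed.

HB.instance Definition _ :=
  GRing.isZmodMorphism.Build qmatrix qmatrix torus_act (quot_lift_zmod f0).
HB.instance Definition _ :=
  GRing.isMonoidMorphism.Build qmatrix qmatrix torus_act (quot_lift_monoid f0).
HB.instance Definition _ :=
  GRing.isScalable.Build F qmatrix qmatrix *:%R torus_act (quot_lift_scalable f0).

Lemma torus_actX i j : torus_act (qX i j) = (a i * b j) *: qX i j.
Proof. by apply: etrans (quot_lift_pi f0 _) _; apply: flift_var. Qed.

End Torus.

End QuantumMatrices.

Section Minors.
Variables (m n : nat) (F : fieldType) (q : F).
Local Notation Oq := (qmatrix m n q).

Definition perm_length r (s : 'S_r) : nat :=
  #|[set p : 'I_r * 'I_r | (p.1 < p.2)%N && (s p.2 < s p.1)%N]|.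

(* enum_val lists the elements of a set of ordinals in increasing order.
   The value 0 is junk: minors have row and column sets of equal size. *)
Definition qminor (ST : {set 'I_m} * {set 'I_n}) : Oq :=
  if #|ST.1| =P #|ST.2| is ReflectT eST then
    \sum_(s : 'S_#|ST.1|) (- q) ^+ perm_length s *:
      \prod_(r < #|ST.1|) qX q (enum_val r) (enum_val (cast_ord eST (s r)))
  else 0.

Definition H_invariant (K : set Oq) : Prop :=
  forall (a : 'I_m -> F) (b : 'I_n -> F),
    (forall i, a i != 0) -> (forall j, b j != 0) ->
    (torus_act a b @` K = K)%classic.

Definition H_prime (K : set Oq) : Prop := prime_ideal K /\ H_invariant K.

End Minors.

(* A diagram is given by the set C of its black squares. *)
Section Diagrams.
Variables m n : nat.
Local Notation square := ('I_m * 'I_n)%type.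
Implicit Types (C : {set square}) (b w : square).

Definition cauchon C : Prop :=
  forall i j, (i, j) \in C ->
    ~ ((exists2 l : 'I_n, (l < j)%N & (i, l) \notin C) /\
       (exists2 k : 'I_m, (k < i)%N & (k, j) \notin C)).

Definition vertex := ('I_m + square + 'I_n)%type.
Definition source (i : 'I_m) : vertex := inl (inl i).
Definition sink (j : 'I_n) : vertex := inr j.

Definition edge C : rel vertex := fun u v =>
  match u, v with
  | inl (inl i), inl (inr (k, j)) =>
      [&& k == i, (i, j) \notin C & [forall l : 'I_n, (j < l)%N ==> ((i, l) \in C)]]
  | inl (inr (i, j)), inl (inr (k, l)) =>
      [&& (i, j) \notin C, (k, l) \notin C
        & [&& k == i, (l < j)%N
            & [forall c : 'I_n, (l < c < j)%N ==> ((i, c) \in C)]]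
          || [&& l == j, (i < k)%N
               & [forall c : 'I_m, (i < c < k)%N ==> ((c, j) \in C)]]]
  | inl (inr (i, j)), inr l =>
      [&& l == j, (i, j) \notin C & [forall c : 'I_m, (i < c)%N ==> ((c, j) \in C)]]
  | _, _ => false
  end.

(* P i is the path from the source of row i, without its initial vertex. *)
Definition linked C (ST : {set 'I_m} * {set 'I_n}) : Prop :=
  exists (f : 'I_m -> 'I_n) (P : 'I_m -> seq vertex),
  [/\ f @: ST.1 = ST.2,
      {in ST.1, forall i, path (edge C) (source i) (P i) /\
                          last (source i) (P i) = sink (f i)}
    & {in ST.1 &, forall i k, i != k ->
         [disjoint source i :: P i & source k :: P k]}].

Definition has_cauchon_diagram (F : fieldType) (q : F) (K : set (qmatrix m n q)) C :
    Prop :=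
  forall ST : {set 'I_m} * {set 'I_n}, #|ST.1| = #|ST.2| ->
    (K (qminor q ST) <-> ~ linked C ST).

Fact box_ltn b : ((rev_ord b.1 + b.2).+1 < m + n)%N.
Proof. by rewrite -addnS -addSn leq_add. Qed.

(* In the 1-based numbering, (i, j) is in row a = m - i from the bottom and in
   column c = j + 1, and s_(a+c-1) exchanges a+c-1 and a+c. *)
Definition box_transp b : {perm 'I_(m + n)} :=
  tperm (Ordinal (ltnW (box_ltn b))) (Ordinal (box_ltn b)).

Definition reading_word C : seq square :=
  [seq b <- [seq (i, j) | i <- enum 'I_m, j <- enum 'I_n] | b \in C].

(* In MathComp s * t is "s, then t"; hence the reversal. *)
Definition restricted_perm C : {perm 'I_(m + n)} :=
  (\prod_(b <- rev (reading_word C)) box_transp b)%g.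

Definition region C (strict : bool) b : {set square} :=
  [set w | (w \notin C) &&
           (if strict then (w.1 < b.1)%N && (w.2 < b.2)%N
                      else (w.1 <= b.1)%N && (w.2 <= b.2)%N)].

Definition nearest C (strict : bool) b : option square :=
  [pick w in region C strict b |
     [forall u in region C strict b,
        (b.1 - w.1 <= b.1 - u.1)%N && (b.2 - w.2 <= b.2 - u.2)%N]].

Fixpoint chain_from C (fuel : nat) w : seq square :=
  if fuel is k.+1 then
    w :: (if nearest C true w is Some w' then chain_from C k w' else [::])
  else [::].

(* The row index decreases along a chain, so that m steps suffice. *)
Definition chain C b : seq square :=
  if (if b \notin C then Some b else nearest C false b) is Some w
  then chain_from C m w else [::].

Lemma chain_fromE C w :
  chain_from C m w =
  w :: (if nearest C true w is Some w' then chain_from C m w' else [::]).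
Proof.
have nearest_lt u v : nearest C true u = Some v -> (v.1 < u.1)%N.
  by rewrite /nearest; case: pickP => // x /andP[+ _] [<-];
     rewrite inE => /and3P[].
have stable k l (u : square) : (u.1 < k)%N -> (u.1 < l)%N ->
    chain_from C k u = chain_from C l u.
  elim: k l u => // k IH [//|l] u uk ul /=.
  case E: nearest => [v|//]; congr (_ :: _).
  by apply: IH; apply: leq_trans (nearest_lt _ _ E) _.
rewrite -[LHS](stable m.+1 m w) //=; first exact: leqW.
Qed.

Definition chain_index C b : {set 'I_m} * {set 'I_n} :=
  ([set i in [seq w.1 | w <- chain C b]], [set j in [seq w.2 | w <- chain C b]]).

(* b is the square labelled k, for 1 <= k <= m + n - 1. *)
Definition box_label b (k : nat) : bool :=
  ((b.1.+1 == m) && (k == b.2.+1)) ||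
  ((b.2.+1 == n) && (k == n + rev_ord b.1)%N).

Lemma box_label_exists k : (0 < m)%N -> (0 < n)%N -> (0 < k < m + n)%N ->
  exists! b, box_label b k.
Proof.
move=> m0 n0 kmn.
have im : ((if (k <= n)%N then m.-1 else m + n - k.+1) < m)%N by case: ifP; lia.
have jn : ((if (k <= n)%N then k.-1 else n.-1) < n)%N by case: ifP; lia.
exists (Ordinal im, Ordinal jn); split=> [|[i j]]; rewrite /box_label /=.
  by move: im jn; case: ifP; lia.
move: (ltn_ord i) (ltn_ord j) => i_lt j_lt kE.
by congr (_, _); apply: val_inj => /=; case: ifP; lia.
Qed.

(* p1 I is I meet {1..m}, and p2 I is (I meet {m+1..m+n}) - m. *)
Definition p1 (I : {set 'I_(m + n)}) : {set 'I_m} := [set i | lshift n i \in I].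
Definition p2 (I : {set 'I_(m + n)}) : {set 'I_n} := [set j | rshift m j \in I].

(* The row and column sets of the minors of the separating Ore set; the column
   set is shifted by -m, and rev_ord is w_m^o. *)
Definition fy_index C (k : nat) : {set 'I_m} * {set 'I_n} :=
  let I := restricted_perm C @: [set x : 'I_(m + n) | (x < k)%N] in
  if (k <= n)%N then
    (@rev_ord m @: p1 I, [set j : 'I_n | (j < k)%N] :\: p2 I)
  else
    (@rev_ord m @: (p1 I :\: [set i : 'I_m | (i < k - n)%N]), [set: 'I_n] :\: p2 I).

End Diagrams.

Section Necklace.
Variables (m n : nat) (F : fieldType) (q : F) (K : set (qmatrix m n q)).
Implicit Types I J : {set 'I_(m + n)}.

(* In the 1-based numbering, T_I is the set of the m + n + 1 - j for j in I with
   j > m; for j = m + c this is n + 1 - c. *)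
Definition minor_index I : {set 'I_m} * {set 'I_n} :=
  (~: p1 I, @rev_ord n @: p2 I).

(* The total order i < i+1 < ... < i-1, through the position relative to i. *)
Definition cyc_le (i : 'I_(m + n)) : rel 'I_(m + n) := fun x y =>
  ((x + (m + n - i)) %% (m + n) <= (y + (m + n - i)) %% (m + n))%N.

Definition gale_le (i : 'I_(m + n)) I J : bool :=
  all2 (cyc_le i) (sort (cyc_le i) (enum I)) (sort (cyc_le i) (enum J)).

Definition nonzero_minor I : Prop := #|I| = m /\ ~ K (qminor q (minor_index I)).

(* necklace i is the least element K_(i+1) for gale_le i. *)
Definition necklace (i : 'I_(m + n)) : {set 'I_(m + n)} :=
  xget (finset.set0) [set I | nonzero_minor I /\
                     forall J, nonzero_minor J -> gale_le i I J]%classic.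

End Necklace.

(* Main.v *)
Require Import Defs.
From mathcomp Require Import all_boot all_algebra perm zify.
From mathcomp Require Import boolp classical_sets cardinality.

Set Implicit Arguments.
Unset Strict Implicit.
Unset Printing Implicit Defensive.

(* Fix a box b = (R, N) of the bottom row or of the last column, and let X be its
   chain. X is a strict north-west chain of white squares with i <= R, j <= N, and
   by the Cauchon condition every other such white square (i, j) is either above
   a square of X in its column (north-east side) or to the left of a square of X
   in its row (south-west side).

   First part: read the word of the restricted permutation as a pipe dream, in
   which pipes enter at the south-east boundary, go straight through the black
   boxes, turn in the white ones and leave at the north-west boundary. If the
   pipes 1, ..., k are those which enter the rectangle [1, R] x [1, N] from
   below, then in that rectangle the occupied left (resp. free top) edges are
   the segments going left (resp. up) from the squares of X. Hence the occupied
   left edges of the boundary are the rows of X and the free top edges are its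
   columns.

   Second part: a path from a source of row <= R to a sink of column <= N goes
   from the north-east to the south-west side of X and cannot jump over X, so
   it meets X. Disjoint paths meet X in distinct squares, which bounds the
   number of elements that an m-subset with a nonzero minor can have in an
   initial segment of the order <=_i, for R and N given by k = m + n + 1 - i.
   The bound is attained by the subset of X, whose minor is nonzero: its paths
   are the nested hooks that go left to a square of X and then down. So the
   necklace term K_i is the subset of X. *)

(** * Nearest white squares and chains *)

Section Chains.
Variables m n : nat.
Local Notation square := ('I_m * 'I_n)%type.
Implicit Types (C X : {set square}) (b u w : square).

Lemma mem_region C strict b w :
  w \in region C strict b -> [/\ w \notin C, w.1 <= b.1 & w.2 <= b.2].
Proof.
by rewrite inE => /andP[wC]; case: strict => /andP[w1 w2]; split=> //; exact: ltnW.
Qed.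

Lemma nearest_some C strict b w :
  nearest C strict b = Some w ->
  w \in region C strict b /\
  forall u, u \in region C strict b -> u.1 <= w.1 /\ u.2 <= w.2.
Proof.
rewrite /nearest; case: pickP => // -[x1 x2] /andP[xR /forall_inP xmin] [<-].
split=> // u uR; have /andP[] := xmin u uR.
by have [_ /= ? ?] := mem_region uR; have [_ /= ? ?] := mem_region xR; lia.
Qed.

Lemma nearest_none C strict b :
  cauchon C -> nearest C strict b = None -> region C strict b = finset.set0.
Proof.
move=> cC; rewrite /nearest; case: pickP => // nonear _.
case: (set_0Vmem (region C strict b)) => // -[w wR].
have [[u1 u2] uR umax] :=
  @arg_maxnP _ w (mem (region C strict b)) (fun u => u.1 : nat) wR.
have [[v1 v2] vR vmax] :=
  @arg_maxnP _ w (mem (region C strict b)) (fun u => u.2 : nat) wR.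
have /= uv := umax _ vR; have /= vu := vmax _ uR.
(* Were the square of row u1 and column v2 black, it would have the white (u1, u2)
   to its left and the white (v1, v2) above it. *)
have uvR : (u1, v2) \in region C strict b.
  move: uR vR; rewrite !inE /= => /andP[uC ub] /andP[vC vb].
  apply/andP; split; last by move: ub vb; case: (strict); lia.
  have [uv2|uv2] := eqVneq (u2 : nat) v2; first by rewrite -(val_inj uv2).
  have [uv1|uv1] := eqVneq (u1 : nat) v1; first by rewrite (val_inj uv1).
  by apply/negP => /cC[]; split; [exists u2 | exists v1]; rewrite //; lia.
have /negP[] := nonear (u1, v2); rewrite uvR /=; apply/forall_inP => -[x1 x2] xR.
by have /= := umax _ xR; have /= := vmax _ xR; lia.
Qed.

(* The properties of the chain X rooted at b from which everything follows. *)
Definition staircase C b X : Prop :=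
  [/\ forall w : square, w \in X -> [/\ w \notin C, w.1 <= b.1 & w.2 <= b.2],
      forall u w : square, u \in X -> w \in X -> (u.1 < w.1) = (u.2 < w.2)
    & forall u : square, u \notin C -> u.1 <= b.1 -> u.2 <= b.2 ->
        exists2 w : square, w \in X &
          ((u.1 == w.1 :> nat) && (u.2 <= w.2)) ||
          ((u.2 == w.2 :> nat) && (u.1 <= w.1))].

(** A white square weakly north-west of [w] shares its row or column, or is strictly north-west of
    it and so weakly north-west of the next chain square, where induction applies. Rows decrease
    along the chain, so fuel above [w.1] suffices. *)
Lemma chain_from_staircase C k w :
  cauchon C -> w \notin C -> w.1 < k ->
  staircase C w [set u in chain_from C k w].
Proof.
move=> cC; elim: k w => // k IH w wC wk /=.
case E: (nearest C true w) => [w'|].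
  have [w'R w'max] := nearest_some E.
  have /and3P[w'C w1 w2] : [&& w' \notin C, w'.1 < w.1 & w'.2 < w.2].
    by move: w'R; rewrite inE.
  have [||X1 X2 X3] := IH w' => //; first by lia.
  split=> [u|u v|u uC u1 u2].
  - rewrite !inE => /predU1P[->|uX] /=; first by split.
    by have [|? ? ?] := X1 u; rewrite ?inE //; split=> //; lia.
  - rewrite !inE => /predU1P[->|uX] /predU1P[->|vX] /=; first by rewrite !ltnn.
    + by have [|_ ? ?] := X1 v; rewrite ?inE //; lia.
    + by have [|_ ? ?] := X1 u; rewrite ?inE //; lia.
    + by apply: X2; rewrite inE.
  - have [uw|uw] := boolP ((u.1 == w.1 :> nat) || (u.2 == w.2 :> nat)).
      by exists w; [rewrite !inE eqxx | move=> /=; lia].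
    have uR : u \in region C true w by rewrite inE uC /=; lia.
    have [u1' u2'] := w'max u uR; have [v] := X3 u uC u1' u2'.
    by move=> /=; rewrite inE => vX uv; exists v; rewrite // !inE vX orbT.
have noR := nearest_none cC E.
split=> [u|u v|u uC u1 u2].
- by rewrite !inE => /eqP->; split.
- by rewrite !inE => /eqP-> /eqP->; rewrite !ltnn.
- exists w; first by rewrite !inE eqxx.
  by move/finset.setP/(_ u): noR; rewrite !inE uC /=; lia.
Qed.

Lemma chain_staircase C b : cauchon C -> staircase C b [set u in chain C b].
Proof.
move=> cC; rewrite /chain; case: ifPn => bC.
  exact: chain_from_staircase.
case E: nearest => [w|].
  have [/mem_region[wC w1 w2] wmax] := nearest_some E.
  have [X1 X2 X3] := chain_from_staircase cC wC (ltn_ord w.1).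
  split=> // [u uX|u uC u1 u2]; first by have [? ? ?] := X1 u uX; split=> //; lia.
  have uR : u \in region C false b by rewrite inE uC /=; lia.
  by have [u1' u2'] := wmax u uR; apply: X3.
have noR := nearest_none cC E.
split=> [u|u v|u uC u1 u2]; rewrite ?inE //.
by move/finset.setP/(_ u): noR; rewrite !inE uC u1 u2.
Qed.

Lemma chain_indexE C b :
  chain_index C b =
  (fst @: [set u in chain C b], snd @: [set u in chain C b]).
Proof.
by congr (_, _); apply/finset.setP => i; rewrite inE;
  apply/mapP/imsetP => -[w wX ->]; exists w; rewrite ?inE // in wX *.
Qed.


End Chains.

(** * Pipe dreams and the action of the restricted permutation *)

Section Pipes.
Variables m n : nat.
Local Notation square := ('I_m * 'I_n)%type.
Implicit Types u : square.
Variables (C : {set square}) (hpipe vpipe : nat -> nat -> bool).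

(* hpipe i j (resp. vpipe i j) tells whether a pipe crosses the left (resp. top)
   edge of box (i, j); column n and row m give the south-east boundary. *)
Definition pipes_ok : Prop := forall u : square,
  if u \in C
  then hpipe u.1 u.2 = hpipe u.1 u.2.+1 /\ vpipe u.1 u.2 = vpipe u.1.+1 u.2
  else hpipe u.1 u.2 = vpipe u.1.+1 u.2 /\ vpipe u.1 u.2 = hpipe u.1 u.2.+1.

(* The state of the p-th strand once the boxes from (i, j) on, in reading order,
   have been passed. From p = 0, the strands are at the left edges of the rows
   below i, the top edges of row i + 1 in columns < j, the left edge of (i, j),
   the top edges of row i in columns >= j, the right ends of the rows above. *)
Definition frontier (i j p : nat) : bool :=
  if p < m - i.+1 then hpipe (m - p.+1) 0
  else if p < m - i.+1 + j then vpipe i.+1 (p - (m - i.+1))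
  else if p == m - i.+1 + j then hpipe i j
  else if p <= m - i.+1 + n then vpipe i (p - (m - i.+1)).-1
  else hpipe (m + n - p.+1) n.

Lemma frontier_row i p : i.+1 < m -> p < m + n ->
  frontier i n p = frontier i.+1 0 p.
Proof.
move=> im pmn; rewrite /frontier addn0.
have [p1|p1] := ltnP p (m - i.+2); first by rewrite (_ : p < m - i.+1); last lia.
have [p2|p2] := eqVneq p (m - i.+2).
  by subst p; rewrite (_ : m - i.+2 < m - i.+1) ?ltnn; [congr hpipe; lia | lia].
rewrite (_ : p < m - i.+1 = false); last by lia.
have [p3|p3] := ltnP p (m - i.+1 + n).
  by rewrite (_ : p <= m - i.+2 + n); [congr vpipe; lia | lia].
rewrite (_ : p <= m - i.+2 + n = false); last by lia.
have [p4|p4] := eqVneq p (m - i.+1 + n); first by congr hpipe; lia.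
by rewrite (_ : p <= _ = false); last by lia.
Qed.

(** Only strands [p] and [p.+1] change: they move from the bottom and right edges of the box to its
    left and top edges. Going straight through a black box swaps them; turning in a white one does
    not. *)
Lemma frontier_box u (x : 'I_(m + n)) : pipes_ok ->
  frontier u.1 u.2 x =
  frontier u.1 u.2.+1 (if u \in C then box_transp u x else x).
Proof.
move=> /(_ u) ok; have u1 := ltn_ord u.1; have u2 := ltn_ord u.2.
set p := m - u.1.+1 + u.2.
have F1 : frontier u.1 u.2 p = hpipe u.1 u.2.
  by rewrite /frontier eqxx ltnn (_ : p < _ = false); last by lia.
have F2 : frontier u.1 u.2 p.+1 = vpipe u.1 u.2.
  rewrite /frontier (_ : p.+1 < _ = false); last by lia.
  rewrite ltnNge leqnSn /= eqn_leq ltnn /= (_ : p < _); last by lia.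
  by congr vpipe; lia.
have F3 : frontier u.1 u.2.+1 p = vpipe u.1.+1 u.2.
  rewrite /frontier (_ : p < _ = false); last by lia.
  by rewrite addnS leqnn; congr vpipe; lia.
have F4 : frontier u.1 u.2.+1 p.+1 = hpipe u.1 u.2.+1.
  rewrite /frontier (_ : p.+1 < _ = false); last by lia.
  by rewrite addnS ltnn eqxx.
have F5 (y : nat) : y != p -> y != p.+1 ->
    frontier u.1 u.2 y = frontier u.1 u.2.+1 y.
  move=> /eqP y1 /eqP y2; rewrite /frontier addnS -/p (ltnS y p) (leq_eqVlt y p).
  by case: eqP => // _; case: eqP.
have pE : rev_ord u.1 + u.2 = p by [].
case: ifP ok => uC [ok1 ok2]; last first.
  have [xp|xp] := eqVneq (x : nat) p; first by rewrite xp F1 F3.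
  have [xp'|xp'] := eqVneq (x : nat) p.+1; first by rewrite xp' F2 F4.
  exact: F5.
rewrite /box_transp; case: tpermP => [-> /=|-> /=|]; rewrite ?pE.
- by rewrite F1 F4.
- by rewrite F2 F3.
- by move=> xp xp'; apply: F5; apply/eqP => E; [apply: xp | apply: xp'];
     apply: val_inj; rewrite /= E.
Qed.

Variable A : {set 'I_(m + n)}.
Hypothesis ok : pipes_ok.
Hypothesis A_frontier : forall x : 'I_(m + n), (x \in A) = frontier m.-1 n x.

Let black (s : seq square) := [seq u <- s | u \in C].
Let image (s : seq square) : {set 'I_(m + n)} :=
  (\prod_(u <- rev (black s)) box_transp u)%g @: A.

(** The head of the word acts last, and a transposition is its own inverse. *)
Lemma mem_image_cons u s x :
  (x \in image (u :: s)) = ((if u \in C then box_transp u x else x) \in image s).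
Proof.
rewrite /image /black /=; case: ifP => // _.
rewrite rev_cons -cats1 big_cat big_seq1 /=.
apply/imsetP/imsetP => -[y yA E]; exists y => //.
  by rewrite E permM tpermK.
by rewrite permM -E tpermK.
Qed.

Lemma frontier_seq i (t : seq square) (r : 'I_m) :
  r = i :> nat ->
  (forall x : 'I_(m + n), (x \in image t) = frontier i n x) ->
  forall j, j <= n -> forall x : 'I_(m + n),
    (x \in image ([seq (r, c) | c <- drop j (enum 'I_n)] ++ t)) = frontier i j x.
Proof.
move=> ri tE j; move: {-1}(n - j) (erefl (n - j)) => k.
elim: k j => [|k IH] j nj jn x.
  by rewrite drop_oversize ?size_enum_ord /= ?tE; [congr frontier; lia | lia].
have jn' : j < n by lia.
rewrite (drop_nth (Ordinal jn')) ?size_enum_ord //= mem_image_cons.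
rewrite IH; try lia.
have -> : nth (Ordinal jn') (enum 'I_n) j = Ordinal jn'.
  by apply: val_inj; rewrite /= nth_enum_ord.
by rewrite -ri -(frontier_box (r, Ordinal jn') x).
Qed.

(* The word is multiplied from right to left, hence acts from its last letter. *)
Lemma restricted_perm_frontier (x : 'I_(m + n)) : 0 < m ->
  (x \in restricted_perm C @: A) = frontier 0 0 x.
Proof.
move=> m0; rewrite /restricted_perm /reading_word -/(black _) -/(image _).
suff H i : i < m -> forall x : 'I_(m + n),
    (x \in image [seq (r, c) | r <- drop i (enum 'I_m), c <- enum 'I_n]) =
    frontier i 0 x.
  by have := H 0 m0 x; rewrite drop0.
move: {-1}(m - i) (erefl (m - i)) => k; elim: k i => [|k IH] i mi im {}x; first by lia.
rewrite (drop_nth (Ordinal im)) ?size_enum_ord //=.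
set r := nth _ _ _; rewrite -{1}(drop0 (enum 'I_n)).
apply: frontier_seq => //; first by rewrite /r nth_enum_ord.
move=> {}x; have [im'|im'] := ltnP i.+1 m.
  by rewrite IH ?frontier_row //; lia.
rewrite drop_oversize ?size_enum_ord //= /image /= big_nil.
have -> : i = m.-1 by lia.
by rewrite -A_frontier (eq_imset _ (@perm1 _)) imset_id.
Qed.

End Pipes.

Lemma mem_imset_rev_ord k (A : {set 'I_k}) i :
  (i \in @rev_ord k @: A) = (rev_ord i \in A).
Proof. by rewrite -{1}(rev_ordK i) mem_imset //; exact: rev_ord_inj. Qed.

(** * The pipe dream cut out by a chain *)

Section StaircasePipes.
Variables m n : nat.
Local Notation square := ('I_m * 'I_n)%type.
Variables (C : {set square}) (b : square) (X : {set square}).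
Implicit Types u w : square.

(* The pipes entering from below the rectangle of rows <= b.1 and columns <= b.2.
   The rows below it, if any, are then filled, and the columns to its right, if
   any, are empty. *)
Definition chain_hpipe (i j : nat) : bool :=
  (b.1 < i) || [exists w : square, [&& w \in X, i == w.1 :> nat & j <= w.2]].

Definition chain_vpipe (i j : nat) : bool :=
  (j <= b.2) && ~~ [exists w : square, [&& w \in X, j == w.2 :> nat & i <= w.1]].

Hypothesis stC : staircase C b X.

Lemma staircase_inj u w : u \in X -> w \in X ->
  (u.1 == w.1 :> nat) || (u.2 == w.2 :> nat) -> u = w.
Proof.
move=> uX wX uw; have [_ X2 _] := stC; have := X2 u w uX wX; have := X2 w u wX uX.
move=> E1 E2; rewrite [u]surjective_pairing [w]surjective_pairing.
by congr (_, _); apply: val_inj => /=; lia.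
Qed.

Lemma staircase_fst_inj : {in X &, injective fst}.
Proof.
by move=> u w uX wX uw; apply: (staircase_inj uX wX); rewrite uw eqxx.
Qed.

Lemma staircase_snd_inj : {in X &, injective snd}.
Proof.
by move=> u w uX wX uw; apply: (staircase_inj uX wX); rewrite uw eqxx orbT.
Qed.

Lemma staircase_card : #|fst @: X| = #|snd @: X|.
Proof.
by rewrite !card_in_imset //; [exact: staircase_snd_inj | exact: staircase_fst_inj].
Qed.

Hypothesis bR : (b.1.+1 == m) || (b.2.+1 == n).

(** Black boxes are not in [X], so segments pass straight through them. In the rectangle, a box of
    [X] has its left and bottom edges occupied and the other two free; another white box has all
    four edges occupied if it is left of [X], and none if it is above [X]. *)
Lemma chain_pipes_ok : pipes_ok C chain_hpipe chain_vpipe.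
Proof.
have [X1 X2 X3] := stC; move=> u.
have u1 := ltn_ord u.1; have u2 := ltn_ord u.2.
have hP i j : reflect (b.1 < i \/ exists2 w : square, w \in X & i = w.1 /\ j <= w.2)
    (chain_hpipe i j).
  apply: (iffP orP) => -[|]; try by left.
    by case/existsP => w /and3P[wX /eqP iw jw]; right; exists w.
  by case=> w wX [iw jw]; right; apply/existsP; exists w; rewrite wX iw eqxx.
have vP i j : reflect (j <= b.2 /\ forall w, w \in X -> j = w.2 -> w.1 < i)
    (chain_vpipe i j).
  apply: (iffP andP) => -[jb jX]; split=> //.
    move=> w wX jw; rewrite ltnNge; apply: contra jX => iw.
    by apply/existsP; exists w; rewrite wX jw eqxx.
  by apply/existsP => -[w /and3P[wX /eqP jw]]; rewrite leqNgt jX.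
case: ifPn => uC.
  have uX (w : square) : w \in X -> u.1 = w.1 :> nat -> u.2 = w.2 :> nat -> False.
    move=> wX /val_inj uw1 /val_inj uw2; have [/negP[]] := X1 w wX.
    by rewrite (surjective_pairing w) -uw1 -uw2 -surjective_pairing.
  split; apply/idP/idP.
  - case/hP => [?|[w wX [w1 w2]]]; apply/hP; [by left | right; exists w => //].
    by have := uX w wX; lia.
  - case/hP => [?|[w wX [w1 w2]]]; apply/hP; [by left | right; exists w => //].
    by lia.
  - by case/vP => ub uX'; apply/vP; split=> // w wX /(uX' w wX); lia.
  - case/vP => ub uX'; apply/vP; split=> // w wX uw.
    by have := uX' w wX uw; have := uX w wX; lia.
(* If there are rows below the rectangle, [bR] makes it span all columns, so every edge of [u] is
   occupied there. *)
have [bu1|ub1] := ltnP b.1 u.1.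
  rewrite /chain_hpipe bu1 /=; split; [apply/esym|]; apply/vP;
    by split=> [|w wX _]; [lia | have [_ ? _] := X1 w wX; lia].
have [bu2|ub2] := ltnP b.2 u.2.
  rewrite /chain_vpipe (leqNgt u.2) bu2 /=.
  split; [|apply/esym]; apply/negbTE/negP => /hP;
    by case=> [|[w wX [_ w2]]]; [lia | have [_ _ ?] := X1 w wX; lia].
have [w wX uw] := X3 u uC ub1 ub2.
have ord (v : square) : v \in X ->
    (v.2 < w.2) = (v.1 < w.1) /\ (w.2 < v.2) = (w.1 < v.1).
  by move=> vX; rewrite !X2.
have nh : u.2 = w.2 :> nat -> u.1 <= w.1 -> ~~ chain_hpipe u.1 u.2.+1.
  move=> uw2 uw1; apply/negP => /hP[|[v vX [uv1 uv2]]]; first by lia.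
  by have := ord v vX; lia.
have nv : u.2 = w.2 :> nat -> u.1 <= w.1 -> ~~ chain_vpipe u.1 u.2.
  by move=> uw2 uw1; apply/negP => /vP[_ /(_ w wX uw2)]; lia.
have yh : u.1 = w.1 :> nat -> u.2 <= w.2 -> chain_hpipe u.1 u.2.
  by move=> uw1 uw2; apply/hP; right; exists w.
have yv : u.1 = w.1 :> nat -> u.2 <= w.2 -> chain_vpipe u.1.+1 u.2.
  by move=> uw1 uw2; apply/vP; split=> // v vX uv; have := ord v vX; lia.
have [uw1|uw1] := eqVneq (u.1 : nat) w.1; have [uw2|uw2] := eqVneq (u.2 : nat) w.2.
- by rewrite (negPf (nh _ _)) ?(negPf (nv _ _)) ?yh ?yv //; lia.
- rewrite yh ?yv; try lia; split=> //.
  rewrite (_ : chain_vpipe _ _); last first.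
    by apply/vP; split=> // v vX uv; have := ord v vX; lia.
  by apply/esym/hP; right; exists w => //; lia.
- rewrite (negPf (nh _ _)) ?(negPf (nv _ _)); try lia; split=> //.
  rewrite (_ : chain_hpipe _ _ = false); last first.
    apply/negP => /hP[|[v vX [uv1 uv2]]]; first by lia.
    by have := ord v vX; lia.
  by apply/esym/negP => /vP[_ /(_ w wX uw2)]; lia.
- by lia.
Qed.

(** The initial strands run along the bottom edges from left to right, then up the right ends of the
    rows; the first [k] are those that enter the rectangle from below or from the filled rows under
    it. *)
Lemma chain_frontier (k : nat) (x : 'I_(m + n)) : box_label b k ->
  (x \in [set x : 'I_(m + n) | x < k]) = frontier m n chain_hpipe chain_vpipe m.-1 n x.
Proof.
have [X1 _ _] := stC; have b1 := ltn_ord b.1; have b2 := ltn_ord b.2.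
move=> bk; have xmn := ltn_ord x.
have {}bk : b.1.+1 = m /\ k = b.2.+1 \/ b.2.+1 = n /\ k = n + (m - b.1.+1).
  by move: bk; rewrite /box_label /=; lia.
rewrite inE /frontier prednK ?subnn ?add0n ?subn0; last by lia.
rewrite ltn0; have [xn|xn] := ltnP x n.
  rewrite /chain_vpipe (_ : [exists _, _] = false) ?andbT.
    by lia.
  by apply/existsP => -[[i j] /and3P[_ _ /=]]; have := ltn_ord i; lia.
rewrite [RHS](_ : _ = chain_hpipe (m + n - x.+1) n); last first.
  have [->|xn'] := eqVneq (x : nat) n; first by congr chain_hpipe; lia.
  by rewrite (_ : x <= n = false) //; lia.
rewrite /chain_hpipe (_ : [exists _, _] = false) ?orbF.
  by lia.
by apply/existsP => -[[i j] /and3P[_ _ /=]]; have := ltn_ord j; lia.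
Qed.

(** On the north-west boundary [p1] records occupied left edges, numbered from the bottom, and [p2]
    occupied top edges. The set differences and the bound [k] discard the filled rows below the
    rectangle and the free columns to its right. *)
Lemma fy_index_staircase k : box_label b k ->
  fy_index C k = (fst @: X, snd @: X).
Proof.
move=> bk; have [X1 _ _] := stC; have m0 : 0 < m := leq_ltn_trans (leq0n _) (ltn_ord b.1).
have b1 := ltn_ord b.1; have b2 := ltn_ord b.2.
set I := restricted_perm C @: [set x : 'I_(m + n) | x < k].
have IE (x : 'I_(m + n)) : (x \in I) = frontier m n chain_hpipe chain_vpipe 0 0 x.
  apply: restricted_perm_frontier => // [|y]; first exact: chain_pipes_ok.
  exact: chain_frontier.
have I1 (i : 'I_m) : (lshift n (rev_ord i) \in I) = chain_hpipe i 0.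
  have im := ltn_ord i.
  rewrite IE /frontier /= addn0 (_ : m - (m - i.+1).+1 = i); last by lia.
  case: ltnP => // i1; rewrite eqn_leq i1 andbT leq_subLR.
  by rewrite (_ : m <= i.+1 + (m - 1)); [congr chain_hpipe; lia | lia].
have I2 (j : 'I_n) : (rshift m j \in I) = chain_vpipe 0 j.
  rewrite IE /frontier /= addn0 (_ : _ < _ = false); last by lia.
  rewrite (_ : _ == _ = false); last by lia.
  by rewrite (_ : _ <= _); [congr chain_vpipe; lia | have := ltn_ord j; lia].
have rowE (i : 'I_m) : i <= b.1 -> chain_hpipe i 0 = (i \in fst @: X).
  move=> ib; rewrite /chain_hpipe ltnNge ib /=; apply/existsP/imsetP.
    by case=> w /andP[wX]; rewrite andbT => /eqP/val_inj; exists w.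
  by case=> w wX ->; exists w; rewrite wX eqxx.
have colE (j : 'I_n) : j <= b.2 -> chain_vpipe 0 j = (j \notin snd @: X).
  move=> jb; rewrite /chain_vpipe jb /=; congr negb; apply/existsP/imsetP.
    by case=> w /and3P[wX /eqP/val_inj]; exists w.
  by case=> w wX ->; exists w; rewrite wX eqxx.
have rowX (i : 'I_m) : i \in fst @: X -> i <= b.1.
  by case/imsetP => w wX ->; have [_ ? _] := X1 w wX.
have colX (j : 'I_n) : j \in snd @: X -> j <= b.2.
  by case/imsetP => w wX ->; have [_ _ ?] := X1 w wX.
have {}bk : b.1.+1 = m /\ k = b.2.+1 \/ b.2.+1 = n /\ k = n + (m - b.1.+1).
  by move: bk; rewrite /box_label /=; lia.
rewrite /fy_index -/I; case: ifP => kn; congr (_, _); apply/finset.setP => i.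
- rewrite mem_imset_rev_ord inE I1 rowE //; have := ltn_ord i; lia.
- rewrite !inE I2; have [ib|ib] := leqP i b.2.
    by rewrite colE // negbK (_ : i < k) ?andbT //; lia.
  rewrite (_ : i < k = false) ?andbF; last by lia.
  by apply/esym/negP => /colX; lia.
- rewrite mem_imset_rev_ord !inE I1; have [ib|ib] := leqP i b.1.
    by rewrite rowE // (_ : _ < _ = false) //=; lia.
  rewrite (_ : (rev_ord i < k - n)) /=.
    by apply/esym/negP => /rowX; lia.
  by have := ltn_ord i; lia.
- rewrite !inE andbT I2 colE ?negbK //; have := ltn_ord i; lia.
Qed.

End StaircasePipes.

(** * Vertex-disjoint paths and their meeting with a chain *)

Section Paths.
Variables m n : nat.
Local Notation square := ('I_m * 'I_n)%type.
Variables (C : {set square}) (b : square) (X : {set square}).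
Implicit Types u w : square.

(** The values [m] at sinks and, for [vcol], [n] at sources keep both coordinates monotone along
    edges. *)
Definition vrow (v : vertex m n) : nat :=
  match v with inl (inl i) => i | inl (inr u) => u.1 | inr _ => m end.
Definition vcol (v : vertex m n) : nat :=
  match v with inl (inl _) => n | inl (inr u) => u.2 | inr j => j end.
Definition square_vertex u : vertex m n := inl (inr u).

Lemma edge_vrow_vcol v v' : edge C v v' -> vrow v <= vrow v' /\ vcol v' <= vcol v.
Proof.
case: v v' => [[i|[i j]]|j] [[i'|[i' j']]|j'] //=.
- by case/and3P => /eqP-> _ _; split=> //; exact: ltnW.
- by case/and3P => _ _ /orP[] /and3P[/eqP-> ? _]; split=> //; exact: ltnW.
- by case/and3P => /eqP-> _ _; split=> //; exact: ltnW.
Qed.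

Lemma path_vcol v p : path (edge C) v p -> vcol (last v p) <= vcol v.
Proof.
elim: p v => //= v' p IH v /andP[/edge_vrow_vcol[_ vc] vp].
exact: leq_trans (IH v' vp) vc.
Qed.

Lemma row_path u : u \notin C -> exists p,
  [/\ path (edge C) (source n u.1) p, last (source n u.1) p = square_vertex u
    & forall x, x \in p -> exists2 j : 'I_n, u.2 <= j & x = square_vertex (u.1, j)].
Proof.
case: u => i j /=; move: {2}(n - j) (leqnn (n - j)) => k.
elim: k j => [|k IH] j nj jC; first by have := ltn_ord j; lia.
pose white (l : 'I_n) := (j < l) && ((i, l) \notin C).
have [l0 l0w|nowhite] := pickP white.
  have [l /andP[jl lC] lmin] := arg_minnP (fun l : 'I_n => l : nat) l0w.
  have [|p [pP lastp memp]] := IH l _ lC; first by lia.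
  exists (rcons p (square_vertex (i, j))); split; last 1 first.
  - move=> x; rewrite mem_rcons inE => /predU1P[->|/memp[c lc ->]]; first by exists j.
    by exists c => //; lia.
  - rewrite rcons_path pP lastp /= lC jC eqxx jl /=.
    apply/orP; left; apply/forall_inP => c /andP[jc cl]; apply/contraT => cC.
    by have := lmin c; rewrite /white jc cC /=; lia.
  - by rewrite last_rcons.
exists [:: square_vertex (i, j)]; split=> // [|x].
  rewrite /= eqxx jC andbT; apply/forall_inP => c jc.
  by have := nowhite c; rewrite /white jc /= => /negbFE.
by rewrite inE => /eqP->; exists j.
Qed.

Lemma col_path u : u \notin C -> exists p,
  [/\ path (edge C) (square_vertex u) p, last (square_vertex u) p = sink m u.2
    & forall x, x \in p -> x = sink m u.2 \/
        exists2 i : 'I_m, u.1 < i & x = square_vertex (i, u.2)].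
Proof.
case: u => i j /=; move: {2}(m - i) (leqnn (m - i)) => k.
elim: k i => [|k IH] i mi iC; first by have := ltn_ord i; lia.
pose white (l : 'I_m) := (i < l) && ((l, j) \notin C).
have [l0 l0w|nowhite] := pickP white.
  have [l /andP[il lC] lmin] := arg_minnP (fun l : 'I_m => l : nat) l0w.
  have [|p [pP lastp memp]] := IH l _ lC; first by lia.
  exists (square_vertex (l, j) :: p); split=> [|//|x].
  - rewrite /= pP iC lC eqxx il /= andbT.
    apply/orP; right; apply/forall_inP => c /andP[ic cl]; apply/contraT => cC.
    by have := lmin c; rewrite /white ic cC /=; lia.
  - rewrite inE => /predU1P[->|/memp[->|[c lc ->]]]; [by right; exists l | by left |].
    by right; exists c => //; lia.
exists [:: sink m j]; split=> // [|x].
  rewrite /= eqxx iC andbT /=; apply/forall_inP => c ic.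
  by have := nowhite c; rewrite /white ic /= => /negbFE.
by rewrite inE => /eqP->; left.
Qed.

Hypothesis stC : staircase C b X.

(** If [u] is strictly north-west of [v] in [X], the hook of [v] stays in rows at least [v.1] and
    columns at least [v.2], while each square of the hook of [u] is in row [u.1] or column [u.2],
    past which it turns no further; so the hooks are disjoint. *)
Lemma chain_linked : linked C (fst @: X, snd @: X).
Proof.
have [X1 X2 _] := stC.
(* The path of a square u of X goes left along its row to u, then down. *)
pose hook u (x : vertex m n) : Prop := [\/ x = source n u.1, x = sink m u.2,
  exists2 j : 'I_n, u.2 <= j & x = square_vertex (u.1, j)
  | exists2 i : 'I_m, u.1 < i & x = square_vertex (i, u.2)].
have hookP i : exists uP : square * seq (vertex m n), i \in fst @: X ->
    [/\ uP.1 \in X, i = uP.1.1,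
       path (edge C) (source n i) uP.2, last (source n i) uP.2 = sink m uP.1.2
       & forall x, x \in source n i :: uP.2 -> hook uP.1 x].
  have [/imsetP[u uX ->]|_] := boolP (i \in _); last by exists (b, [::]).
  have [uC _ _] := X1 u uX.
  have [p [pP lastp memp]] := row_path uC; have [r [rP lastr memr]] := col_path uC.
  exists (u, p ++ r); rewrite /= cat_path pP lastp rP last_cat lastp lastr; split=> // x.
  rewrite inE mem_cat => /predU1P[->|/orP[/memp[j uj ->]|/memr[->|[k uk ->]]]].
  - exact: Or41.
  - by apply: Or43; exists j.
  - exact: Or42.
  - by apply: Or44; exists k.
have [g gP] := fin_all_exists hookP.
exists (fun i => (g i).1.2), (fun i => (g i).2); split=> /=.
- apply/finset.setP => j; apply/imsetP/imsetP => -[].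
    by move=> i iX ->; have [gX _ _ _ _] := gP i iX; exists (g i).1.
  move=> u uX ->; have uS : u.1 \in fst @: X by apply: imset_f.
  have [gX ug _ _ _] := gP u.1 uS; exists u.1 => //.
  by rewrite -(staircase_inj stC uX gX) // -ug eqxx.
- by move=> i /gP[].
- move=> i k iS kS ik; have [gX gi _ _ hi] := gP i iS; have [gX' gk _ _ hk] := gP k kS.
  rewrite disjoint_has; apply/hasPn => x /hi xi; apply/negP => /hk xk.
  move/negP: ik; apply.
  rewrite gi gk; apply/eqP; congr (_.1); apply: (staircase_inj stC gX gX').
  have := X2 _ _ gX gX'; have := X2 _ _ gX' gX.
  case: xi xk => [->|->|[j uj ->]|[j uj ->]] [//|//|[l vl]|[l vl]] //.
  all: by move=> E; have /= := congr1 (@vrow) E; have /= := congr1 (@vcol) E; lia.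
Qed.

(* v is on the north-east side of the chain, or not yet in the region of b. *)
Definition before (v : vertex m n) : Prop :=
  match v with
  | inl (inl i) => i <= b.1
  | inl (inr u) => u.1 <= b.1 /\ (b.2 < u.2 \/
      exists2 w : square, w \in X & u.2 = w.2 /\ u.1 < w.1)
  | inr _ => False
  end.

Hypothesis bR : (b.1.+1 == m) || (b.2.+1 == n).

Lemma before_or_hit u : u \notin C -> u.1 <= b.1 ->
  (forall w, w \in X -> u.1 = w.1 -> u.2 < w.2 -> False) ->
  before (square_vertex u) \/ u \in X.
Proof.
have [_ _ X3] := stC; move=> uC ub1 uX.
have [ub2|ub2] := ltnP b.2 u.2; first by left; split=> //; left.
have [w wX uw] := X3 u uC ub1 ub2.
have [uw1|uw1] := eqVneq (u.1 : nat) w.1; have [uw2|uw2] := eqVneq (u.2 : nat) w.2.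
- right; rewrite (surjective_pairing u) (val_inj uw1) (val_inj uw2).
  by rewrite -surjective_pairing.
- by case: (uX w wX); [exact: val_inj | lia].
- by left; split=> //; right; exists w => //; split; [exact: val_inj | lia].
- by lia.
Qed.

(** An edge skips only black squares and those of [X] are white, so it cannot cross [X] without
    ending on it. *)
Lemma edge_before v v' : edge C v v' -> before v ->
  [\/ before v', exists2 w : square, w \in X & v' = square_vertex w
    | exists2 l : 'I_n, v' = sink m l & b.2 < l].
Proof.
have [X1 X2 X3] := stC; have b1 := ltn_ord b.1; have b2 := ltn_ord b.2.
have XC (i : 'I_m) (j : 'I_n) w : w \in X -> i = w.1 -> j = w.2 -> (i, j) \in C -> False.
  by move=> wX -> ->; rewrite -surjective_pairing; have [/negP] := X1 w wX.
have hit u : u \notin C -> u.1 <= b.1 ->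
    (forall w, w \in X -> u.1 = w.1 -> u.2 < w.2 -> False) ->
    [\/ before (square_vertex u),
        exists2 w : square, w \in X & square_vertex u = square_vertex w
      | exists2 l : 'I_n, square_vertex u = sink m l & b.2 < l].
  move=> uC u1 uX; have [?|?] := before_or_hit uC u1 uX; first exact: Or31.
  by apply: Or32; exists u.
case: v v' => [[i|[i j]]|j] [[i'|[k l]]|l] //=.
- case/and3P => /eqP-> iC /forallP right_black ib.
  apply: (hit (i, l)) => //= w wX iw lw; apply: (XC i w.2 w) => //.
  exact: (implyP (right_black w.2)).
- case/and3P => ijC klC /orP[] /and3P[/eqP kl lt /forallP black] [ib jb].
    subst k; apply: (hit (i, l)) => //= w wX iw lw; apply: (XC i w.2 w) => //.
    apply: (implyP (black w.2)); rewrite lw /=.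
    have [_ _ wb2] := X1 w wX.
    case: jb => [jb|[w0 w0X [jw0 iw0]]]; first exact: leq_ltn_trans jb.
    by rewrite jw0 -(X2 w w0) // -iw.
  subst l; case: jb => [jb|[w wX [jw iw]]].
    (* A column beyond [b.2] exists, so [bR] makes [b.1] the last row. *)
    by apply: Or31; split; [have := ltn_ord k; have := ltn_ord j; lia | left].
  have [wk|kw|kw] := ltngtP w.1 k.
  - by case: (XC w.1 j w) => //; apply: (implyP (black w.1)); rewrite iw wk.
  - have [_ ? _] := X1 w wX; apply: Or31; split; first by apply: leq_trans (ltnW kw) _.
    by right; exists w.
  - apply: Or32; exists w => //.
    by rewrite /square_vertex (surjective_pairing w) -jw (val_inj kw).
- case/and3P => /eqP-> ijC /forallP black [ib [jb|[w wX [jw iw]]]].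
  by apply: Or33; exists j.
  by case: (XC w.1 j w) => //; exact: (implyP (black w.1)).
Qed.

Lemma path_hits v p j :
  path (edge C) v p -> before v -> last v p = sink m j -> j <= b.2 ->
  exists w : square, [/\ w \in X, vrow v <= w.1 , j <= w.2 & square_vertex w \in p].
Proof.
elim: p v => [|v' p IH] v /=; first by case: v => //= ? _ [] _ _ [].
case/andP => vv' v'p vb lastv jb; have [vr _] := edge_vrow_vcol vv'.
have := path_vcol v'p; rewrite lastv /= => jv'.
have [v'b|[w wX v'w]|[l v'l lb]] := edge_before vv' vb.
- have [w [wX vw jw wp]] := IH v' v'p v'b lastv jb.
  by exists w; split=> //; [exact: leq_trans vw | rewrite inE wp orbT].
- by exists w; rewrite v'w /= in vr jv' *; rewrite mem_head; split.
(* No edge leaves a sink, so the path would end in a column beyond [b.2]. *)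
- case: p v'p lastv {IH jv'} => [_ /=|x p]; last by rewrite v'l.
  by rewrite v'l => -[lj]; move: lb; rewrite lj ltnNge jb.
Qed.

Lemma linked_hits ST : linked C ST ->
  exists (f : 'I_m -> 'I_n) (h : 'I_m -> square),
  [/\ f @: ST.1 = ST.2, {in ST.1 &, injective f},
      forall i, i \in ST.1 -> i <= b.1 -> f i <= b.2 ->
        [/\ h i \in X, i <= (h i).1 & f i <= (h i).2]
    & {in [pred i | [&& i \in ST.1, i <= b.1 & f i <= b.2]] &, injective h}].
Proof.
case=> f [P [fS PS disjP]].
have lastP i : i \in ST.1 -> sink m (f i) \in source n i :: P i.
  by move=> /PS[_ <-]; exact: mem_last.
have hit i : exists w, [&& i \in ST.1, i <= b.1 & f i <= b.2] ->
    [/\ w \in X, i <= w.1 , f i <= w.2 & square_vertex w \in P i].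
  have [/and3P[iS ib fib]|_] := boolP [&& _, _ & _]; last by exists b.
  have [Pi lastPi] := PS i iS.
  by have [w [wX iw fw wP]] := path_hits Pi ib lastPi fib; exists w.
have [h hP] := fin_all_exists hit.
have neq i k x : i \in ST.1 -> k \in ST.1 -> x \in source n i :: P i ->
    x \in source n k :: P k -> i = k.
  move=> iS kS xi xk; apply/eqP/contraT => ik.
  by have := disjointFr (disjP i k iS kS ik) xi; rewrite xk.
exists f, h; split=> // [i k iS kS fik|i iS ib fib|i k iS kS hik].
- by apply: (neq i k (sink m (f i))) => //; [| rewrite fik]; exact: lastP.
- by have [|? ? ? _] := hP i; rewrite ?iS ?ib ?fib.
- have [_ _ _ wi] := hP i iS; have [_ _ _ wk] := hP k kS.
  case/and3P: iS => iS _ _; case/and3P: kS => kS _ _.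
  by apply: (neq i k (square_vertex (h i))); rewrite // inE ?wi ?hik ?wk orbT.
Qed.

End Paths.

(** * Entrywise comparison of sorted sets by counting *)

Section SortedComparison.
Variables (T : finType) (pos : T -> nat).
Let le : rel T := fun x y => pos x <= pos y.
Implicit Types A B : {set T}.

Let le_trans : transitive le. Proof. by move=> y x z; apply: leq_trans. Qed.
Let le_refl : reflexive le. Proof. by move=> x; apply: leqnn. Qed.
Let le_total : total le. Proof. by move=> x y; apply: leq_total. Qed.

Lemma count_sort_enum A (a : pred T) :
  count a (sort le (enum A)) = #|[set x in A | a x]|.
Proof.
have /seq.permP-> : perm_eq (sort le (enum A)) (enum A) by rewrite perm_sort.
by rewrite -sum1_count big_enum_cond -sum1_card; apply: eq_bigl => x; rewrite inE.
Qed.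

(** If entry [r] of [A] exceeded entry [r] of [B], at position [t], then at most [r] elements of [A]
    but at least [r.+1] of [B] would have position at most [t]. *)
Lemma all2_sort_enum A B : #|A| = #|B| ->
  (forall t, #|[set x in B | pos x <= t]| <= #|[set x in A | pos x <= t]|) ->
  all2 le (sort le (enum A)) (sort le (enum B)).
Proof.
move=> AB counts; rewrite all2E !size_sort -!cardE AB eqxx /=.
have sizeA : size (sort le (enum A)) = #|B| by rewrite size_sort -cardE.
have sizeB : size (sort le (enum B)) = #|B| by rewrite size_sort -cardE.
case: (pickP (@predT T)) => [x0 _|T0]; last first.
  by apply/allP => -[x y]; have := T0 x.
apply/(all_nthP (x0, x0)) => r; rewrite size_zip sizeA sizeB minnn => rB.
rewrite nth_zip ?sizeA // /le /=; rewrite leqNgt; apply/negP => lt_pos.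
have := counts (pos (nth x0 (sort le (enum B)) r)).
rewrite -!count_sort_enum; apply/negP; rewrite -ltnNge.
set t := pos _ in lt_pos *.
have sorted_nth D i j : i <= j -> j < size (sort le (enum D)) ->
    pos (nth x0 (sort le (enum D)) i) <= pos (nth x0 (sort le (enum D)) j).
  move=> ij jD.
  apply: (sorted_leq_nth le_trans le_refl x0 (sort_sorted le_total _)) => //.
  by rewrite inE; apply: leq_ltn_trans jD.
apply: (@leq_ltn_trans r).
  rewrite -(cat_take_drop r (sort le (enum A))) count_cat.
  rewrite (_ : count _ (drop _ _) = 0).
    by rewrite addn0 (leq_trans (count_size _ _)) // size_take sizeA rB.
  apply/eqP; rewrite -leqn0 leqNgt -has_count; apply/hasPn => x.
  case/(nthP x0) => i; rewrite size_drop sizeA => ir <-; rewrite nth_drop -ltnNge.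
  by apply: (leq_trans lt_pos); apply: sorted_nth; rewrite ?sizeA; lia.
rewrite -(cat_take_drop r.+1 (sort le (enum B))) count_cat.
apply: leq_trans (leq_addr _ _).
have sz : size (take r.+1 (sort le (enum B))) = r.+1.
  by rewrite size_take_min sizeB; lia.
rewrite -[X in X <= _]sz leq_eqVlt eq_sym -all_count; apply/orP; left.
apply/(all_nthP x0) => i; rewrite sz => ir; rewrite nth_take //.
by apply: sorted_nth; rewrite ?sizeB.
Qed.

Lemma all2_sort_enum_anti A B : injective pos ->
  all2 le (sort le (enum A)) (sort le (enum B)) ->
  all2 le (sort le (enum B)) (sort le (enum A)) -> A = B.
Proof.
move=> pos_inj AB BA; apply/finset.setP => x.
rewrite -mem_enum -(mem_sort le) -[RHS]mem_enum -[in RHS](mem_sort le).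
suff -> : sort le (enum A) = sort le (enum B) by [].
elim: (sort le (enum A)) (sort le (enum B)) AB BA => [|y s IH] [|z t] //=.
case/andP => yz st /andP[zy ts]; congr (_ :: _); last exact: IH.
by apply: pos_inj; apply/eqP; rewrite eqn_leq [_ <= _]yz.
Qed.

End SortedComparison.

Lemma imset_filter (aT rT : finType) (f : aT -> rT) (A : {set aT}) (a : pred rT) :
  [set y in f @: A | a y] = f @: [set x in A | a (f x)].
Proof.
apply/finset.setP => y; rewrite inE.
apply/andP/imsetP => [[/imsetP[x xA ->] ax]|[x]]; first by exists x; rewrite // inE xA.
by rewrite inE => /andP[xA ax] ->; rewrite imset_f.
Qed.

(** * The correspondence between subsets and minors *)

Section MinorIndex.
Variables m n : nat.
Implicit Types (I J : {set 'I_(m + n)}).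

Lemma card_minor_index J (a : pred 'I_(m + n)) :
  #|[set x in J | a x]| + #|[set i in (minor_index J).1 | a (lshift n i)]| =
  #|[set i : 'I_m | a (lshift n i)]| +
  #|[set j in (minor_index J).2 | a (rshift m (rev_ord j))]|.
Proof.
rewrite -sum1_card (eq_bigl (fun x => (x \in J) && a x)); last by move=> x; rewrite inE.
rewrite big_split_ord /= addnAC; congr (_ + _).
  rewrite -[RHS](cardsID (p1 J)); congr (_ + _).
    by rewrite -sum1_card; apply: eq_bigl => i; rewrite !inE andbC.
  by apply: eq_card => i; rewrite !inE.
rewrite sum1_card -(card_imset _ (@rev_ord_inj n)); apply: eq_card => j.
rewrite !inE mem_imset_rev_ord inE; apply/imsetP/andP => [[k /andP[kJ ak] ->]|[jJ aj]].
  by rewrite rev_ordK.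
by exists (rev_ord j); rewrite ?rev_ordK // unfold_in jJ.
Qed.

Lemma card_minor_index_eq J : #|J| = m <-> #|(minor_index J).1| = #|(minor_index J).2|.
Proof.
have setT (T : finType) (D : {set T}) : [set x in D | true] = D.
  by apply/finset.setP => x; rewrite inE andbT.
have := card_minor_index J predT; rewrite /= !setT.
have -> : [set i : 'I_m | true] = [set: 'I_m] by apply/finset.setP => i; rewrite !inE.
by rewrite cardsT card_ord; lia.
Qed.

Lemma minor_index_surj (ST : {set 'I_m} * {set 'I_n}) : exists J, minor_index J = ST.
Proof.
exists [set x | match split x with
                | inl i => i \notin ST.1 | inr j => rev_ord j \in ST.2 end].
rewrite [RHS]surjective_pairing; congr (_, _); apply/finset.setP => k.
  by rewrite !inE (unsplitK (inl k)) negbK.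
by rewrite mem_imset_rev_ord !inE (unsplitK (inr (rev_ord k))) rev_ordK.
Qed.

End MinorIndex.

(** * Minimality of the subset of a chain *)

Section Necklace.
Variables m n : nat.
Local Notation square := ('I_m * 'I_n)%type.
Variables (C : {set square}) (b : square) (X : {set square}).
Implicit Types (I J : {set 'I_(m + n)}) (u w : square).

Definition cycpos (i x : 'I_(m + n)) : nat := (x + (m + n - i)) %% (m + n).

Lemma cycposE (i x : 'I_(m + n)) :
  i <= x /\ cycpos i x = x - i \/ x < i /\ cycpos i x = x + (m + n - i).
Proof.
have im := ltn_ord i; have xm := ltn_ord x; rewrite /cycpos.
have [ix|ix] := leqP i x; [left | right]; split=> //; last by rewrite modn_small //; lia.
by rewrite (_ : x + (m + n - i) = x - i + (m + n)) ?modnDr ?modn_small; lia.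
Qed.

Lemma cycpos_inj i : injective (cycpos i).
Proof.
move=> x y xy; apply: val_inj => /=; have := cycposE i x; have := cycposE i y.
by have := ltn_ord i; have := ltn_ord x; have := ltn_ord y; lia.
Qed.

Lemma gale_le_anti i I J : gale_le i I J -> gale_le i J I -> I = J.
Proof. exact/(all2_sort_enum_anti (@cycpos_inj i)). Qed.

Definition row_pos i (r : 'I_m) : nat := cycpos i (lshift n r).
Definition col_pos i (c : 'I_n) : nat := cycpos i (rshift m (rev_ord c)).

Variable i : 'I_(m + n).
Hypothesis i0 : 0 < i.
Hypothesis bi : box_label b (m + n - i).

Lemma box_bi : b.1.+1 = m /\ b.2 + i.+1 = m + n \/ b.1.+1 = i /\ b.2.+1 = n.
Proof.
have := ltn_ord i; have := ltn_ord b.1; have := ltn_ord b.2.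
by move: bi; rewrite /box_label /=; lia.
Qed.

Lemma row_posE (r : 'I_m) :
  i <= r /\ row_pos i r = r - i \/ r < i /\ row_pos i r = r + (m + n - i).
Proof. exact: (cycposE i (lshift n r)). Qed.

Lemma col_posE (c : 'I_n) :
  i <= m + (n - c.+1) /\ col_pos i c = m + (n - c.+1) - i \/
  m + (n - c.+1) < i /\ col_pos i c = m + (n - c.+1) + (m + n - i).
Proof. exact: (cycposE i (rshift m (rev_ord c))). Qed.

(** From [i], the order lists columns [b.2] down to 0, all rows, then the other columns when [b] is
    in the bottom row; when [b] is in the last column, the rows below [b.1], all columns, then rows
    0 to [b.1]. *)
Lemma col_pos_lt_row_pos (r : 'I_m) (c : 'I_n) :
  (col_pos i c < row_pos i r) = (r <= b.1) && (c <= b.2).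
Proof.
have := row_posE r; have := col_posE c; have := box_bi.
have := ltn_ord i; have := ltn_ord r; have := ltn_ord c; have := ltn_ord b.1.
by have := ltn_ord b.2; lia.
Qed.

Lemma row_pos_mono (r r' : 'I_m) : r <= r' -> r' <= b.1 -> row_pos i r <= row_pos i r'.
Proof.
have := row_posE r; have := row_posE r'; have := box_bi.
have := ltn_ord i; have := ltn_ord r; have := ltn_ord r'; have := ltn_ord b.1.
by have := ltn_ord b.2; lia.
Qed.

Lemma col_pos_mono (c c' : 'I_n) : c <= c' -> c' <= b.2 -> col_pos i c' <= col_pos i c.
Proof.
have := col_posE c; have := col_posE c'; have := box_bi.
have := ltn_ord i; have := ltn_ord c; have := ltn_ord c'; have := ltn_ord b.1.
by have := ltn_ord b.2; lia.
Qed.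

Hypothesis stC : staircase C b X.

(* Compare the numbers of elements of position <= t. A subset has as many as
   there are rows of position <= t, plus the paths (of a disjoint family for
   its minor) with only the sink at a position <= t, minus those with only the
   source there. A path of the former kind starts and ends within the region of
   b, and the square where it meets X is counted likewise for I; the paths of
   X are never of the latter kind, by col_pos_lt_row_pos. *)
Lemma chain_gale_min I J :
  minor_index I = (fst @: X, snd @: X) -> #|J| = m -> linked C (minor_index J) ->
  gale_le i I J.
Proof.
move=> IX Jm linkJ; have [X1 X2 X3] := stC.
have bR : (b.1.+1 == m) || (b.2.+1 == n) by have [] := box_bi; lia.
have Im : #|I| = m by apply/card_minor_index_eq; rewrite IX (staircase_card stC).
apply: all2_sort_enum => [|t]; first by rewrite Im Jm.
pose A := [set r | row_pos i r <= t].
pose D := [set w in X | (col_pos i w.2 <= t) && (t < row_pos i w.1)].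
have [f [h [fST f_inj hX h_inj]]] := linked_hits stC bR linkJ.
have count J' : #|[set x in J' | cycpos i x <= t]| +
    #|[set r in (minor_index J').1 | row_pos i r <= t]| =
    #|A| + #|[set c in (minor_index J').2 | col_pos i c <= t]|.
  exact: card_minor_index J' (fun x => cycpos i x <= t).
have J_le : #|[set x in J | cycpos i x <= t]| <= #|A| + #|D|.
  move: fST f_inj hX h_inj (count J); case: (minor_index J) => S T /=.
  move=> fST f_inj hX h_inj.
  pose B := [set r in S | (col_pos i (f r) <= t) && (t < row_pos i r)].
  rewrite -fST imset_filter card_in_imset; last first.
    by move=> r r'; rewrite !inE => /andP[rS _] /andP[r'S _]; exact: f_inj.
  have Bsub r : r \in B -> [&& r \in S, r <= b.1 & f r <= b.2].
    rewrite inE => /andP[-> /andP[ct tr]].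
    by rewrite -col_pos_lt_row_pos (leq_ltn_trans ct).
  have BD : #|B| <= #|D|.
    rewrite -(card_in_imset (f := h) (D := mem B)); last first.
      by move=> r r' /Bsub rB /Bsub r'B; exact: h_inj.
    apply/subset_leq_card/fintype.subsetP => _ /imsetP[r rB ->].
    have /and3P[rS rb frb] := Bsub r rB; have [wX rw fw] := hX r rS rb frb.
    have [_ wb1 wb2] := X1 _ wX.
    move: rB; rewrite !inE rS wX /= => /andP[ct tr].
    (* Moving from row [r] and column [f r] down and right to [h r] lowers the column position and
       raises the row position, both weakly. *)
    by rewrite (leq_trans (col_pos_mono fw wb2)) // (leq_trans tr) // row_pos_mono.
  have sub : #|[set r in S | col_pos i (f r) <= t]| <=
         #|[set r in S | row_pos i r <= t]| + #|B|.
    rewrite (leq_trans _ (leq_card_setU _ _)) //.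
    apply/subset_leq_card/fintype.subsetP => r; rewrite !inE => /andP[-> ->] /=.
    by rewrite leqNgt orNb.
  move=> cnt; rewrite -(leq_add2r #|[set r in S | row_pos i r <= t]|) cnt.
  rewrite -addnA leq_add2l.
  by rewrite (leq_trans sub) // addnC leq_add2r.
have I_eq : #|[set x in I | cycpos i x <= t]| = #|A| + #|D|.
  have := count I; rewrite IX /=.
  rewrite !imset_filter !card_in_imset; last 2 first.
  - move=> u w; rewrite !inE => /andP[uX _] /andP[wX _].
    exact: (staircase_snd_inj stC).
  - move=> u w; rewrite !inE => /andP[uX _] /andP[wX _].
    exact: (staircase_fst_inj stC).
  suff -> : #|[set w in X | col_pos i w.2 <= t]| =
            #|[set w in X | row_pos i w.1 <= t]| + #|D|.
    by rewrite addnA addnAC => /addIn.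
  rewrite -(cardsID [set w | row_pos i w.1 <= t]); congr (_ + _); apply: eq_card => w.
    rewrite !inE; case wX: (w \in X) => //=; have [_ wb1 wb2] := X1 w wX.
    have lt_pos : col_pos i w.2 < row_pos i w.1 by rewrite col_pos_lt_row_pos wb1.
    by apply: andb_idl => wt; apply: leq_trans (ltnW lt_pos) wt.
  by rewrite !inE -ltnNge andbC; case: (_ \in X); rewrite //= andbC.
by rewrite I_eq.
Qed.

End Necklace.

Lemma minor_index_necklace (m n : nat) (F : fieldType) (q : F)
    (K : set (qmatrix m n q)) (C : {set 'I_m * 'I_n}) b (i : 'I_(m + n)) :
  cauchon C -> has_cauchon_diagram K C -> 0 < i -> box_label b (m + n - i) ->
  minor_index (necklace K i) = chain_index C b.
Proof.
move=> cC KC i0 bi; have stC := chain_staircase b cC.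
have bR : (b.1.+1 == m) || (b.2.+1 == n) by move: bi; rewrite /box_label; lia.
have nonzeroP J : nonzero_minor K J <-> #|J| = m /\ linked C (minor_index J).
  split=> -[Jm KJ]; split=> //; have/card_minor_index_eq/KC[toL ofL] := Jm.
    by apply: contrapT => nL; apply: KJ; apply: ofL.
  by move/toL.
have [I IE] := minor_index_surj (chain_index C b).
have linkI : linked C (minor_index I) by rewrite IE chain_indexE; exact: chain_linked stC.
have Im : #|I| = m.
  by apply/card_minor_index_eq; rewrite IE chain_indexE; exact: staircase_card stC.
have IX := etrans IE (chain_indexE C b).
suff <- : I = necklace K i by [].
pose N := [set I0 | nonzero_minor K I0 /\
            forall J, nonzero_minor K J -> gale_le i I0 J]%classic.
have NI : N I.
  split; first exact/nonzeroP.
  by move=> J /nonzeroP[Jm linkJ]; exact: (chain_gale_min i0 bi stC IX Jm linkJ).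
(* As [N] contains [I], [xget] returns an element of [N] and not its default. *)
have [nzN minN] : N (necklace K i) by exact: xgetI NI.
by apply: (@gale_le_anti _ _ i); [apply: NI.2 | apply: minN; exact: NI.1].
Qed.

Import GRing.Theory.
Local Open Scope ring_scope.

Theorem theorem1p2 (m n : nat) (F : fieldType) (q : F)
    (C : {set 'I_m * 'I_n}) (K : set (qmatrix m n q)) :
  (2 <= m)%N -> (2 <= n)%N ->
  infinite_set [set: F]%classic ->
  q != 0 -> (forall r : nat, (0 < r)%N -> q ^+ r != 1) ->
  cauchon C -> H_prime K -> has_cauchon_diagram K C ->
  (forall (k : nat) (b : 'I_m * 'I_n), (1 <= k <= m + n - 1)%N -> box_label b k ->
     chain_index C b = fy_index C k /\
     qminor q (chain_index C b) = qminor q (fy_index C k)) /\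
  mulgen [set qminor q (minor_index (necklace K i)) |
            i in [set i : 'I_(m + n) | (1 <= i)%N]]%classic =
  mulgen [set qminor q (fy_index C k) |
            k in [set k : nat | (1 <= k <= m + n - 1)%N]]%classic.
Proof.
move=> m2 n2 _ _ _ cC _ KC.
have fyE k b : box_label b k -> chain_index C b = fy_index C k.
  move=> bk; have bR : (b.1.+1 == m) || (b.2.+1 == n).
    by move: bk; rewrite /box_label; lia.
  by rewrite chain_indexE (fy_index_staircase (chain_staircase b cC) bR bk).
split=> [k b _ bk|]; first by rewrite (fyE k b bk).
(* The 0-based index [i], that is the term K_(i+1), corresponds to the box labelled [m + n - i]. *)
congr (mulgen _); apply/seteqP; split=> x /= [].
  move=> i i0 <-; have im := ltn_ord i.
  have [|||b [bi _]] := @box_label_exists m n (m + n - i); try lia.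
  exists (m + n - i)%N; first by lia.
  by rewrite (minor_index_necklace cC KC i0 bi) (fyE _ _ bi).
move=> k k_range <-; have [|||b [bk _]] := @box_label_exists m n k; try lia.
have kmn : (m + n - k < m + n)%N by lia.
exists (Ordinal kmn) => /=; first by lia.
by rewrite (minor_index_necklace (b := b) cC KC) /= ?(fyE _ _ bk) ?subKn //; lia.
Qed.
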